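(* Let $\lambda\in\mathbb{R}$ and let $n\geq 0$ be an integer. Then for every real $x\neq 0$, \[ \sum_{k=0}^{n}\binom{n}{k}\phi_{k,\lambda}(x)\,(1)_{n-k,\lambda}=\frac{1}{x}\,\phi_{n+1,\lambda}(x)+n\lambda\sum_{k=0}^{n-1}\binom{n-1}{k}\phi_{k,\lambda}(x)\,(1)_{n-k,\lambda}. \]
   Context: For $\lambda\in\mathbb{R}$, the generalized falling factorials are $(x)_{0,\lambda}=1$ and $(x)_{n,\lambda}=x(x-\lambda)(x-2\lambda)\cdots(x-(n-1)\lambda)$ for $n\ge 1$. The degenerate exponential is the formal power series $e_\lambda(t)=\sum_{n\ge 0}(1)_{n,\lambda}\frac{t^n}{n!}$. The degenerate Bell polynomials $\phi_{n,\lambda}(x)$ are defined by the generating function $e^{x(e_\lambda(t)-1)}=\sum_{n=0}^{\infty}\phi_{n,\lambda}(x)\frac{t^n}{n!}$ (as formal power series in $t$). An empty sum is $0$. *)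

(* Defs.v *)
From HB Require Import structures.
From mathcomp Require Import all_boot all_order all_algebra.
From mathcomp Require Import reals.

Set Implicit Arguments.
Unset Strict Implicit.
Unset Printing Implicit Defensive.

Import Order.TTheory GRing.Theory Num.Theory.
Local Open Scope ring_scope.

Definition gen_falling (R : comNzRingType) (lam x : R) (n : nat) : R :=
  \prod_(i < n) (x - i%:R * lam).

(* Formal power series in t over A, f standing for \sum_n (f n) t^n. *)
Definition fps (A : Type) := nat -> A.

Section FPS.
Variable A : nzRingType.
Implicit Types f g : fps A.

Definition fps_one : fps A := fun n => (n == 0%N)%:R.

Definition fps_sub f g : fps A := fun n => f n - g n.

Definition fps_scale (a : A) f : fps A := fun n => a * f n.

Definition fps_mul f g : fps A := fun n => \sum_(i < n.+1) f i * g (n - i)%N.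

Definition fps_pow f m : fps A := iter m (fps_mul f) fps_one.

End FPS.

(* e^f = \sum_m f^m / m!, meaningful when F has characteristic 0 and f 0 = 0. In that
   case f^m has no term of degree < m, so only m <= n contributes to the
   coefficient of t^n; see fps_expE. *)
Definition fps_exp (F : fieldType) (A : algType F) (f : fps A) : fps A :=
  fun n => \sum_(m < n.+1) (m`!%:R : F)^-1 *: fps_pow f m n.

Lemma fps_pow_lt (A : nzRingType) (f : fps A) (m n : nat) :
  f 0%N = 0 -> (n < m)%N -> fps_pow f m n = 0.
Proof.
move=> f0; elim: m n => [//|m IHm] n ltnm.
rewrite /fps_pow iterS /fps_mul big1 // => -[[|i] /= lti] _.
  by rewrite f0 mul0r.
rewrite [iter _ _ _ _]IHm ?mulr0 //.
have n_gt0 : (0 < n)%N by case: (n) lti.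
by rewrite ltnS in ltnm; apply: leq_trans ltnm; rewrite ltn_subrL n_gt0.
Qed.

Lemma fps_expE (F : fieldType) (A : algType F) (f : fps A) (n N : nat) :
  f 0%N = 0 -> (n < N)%N ->
  fps_exp f n = \sum_(m < N) (m`!%:R : F)^-1 *: fps_pow f m n.
Proof.
move=> f0 ltnN; rewrite /fps_exp.
pose G m := (m`!%:R : F)^-1 *: fps_pow f m n.
rewrite -(big_mkord xpredT G) -[RHS](big_mkord xpredT G).
rewrite [RHS](@big_cat_nat _ _ _ n.+1) //=.
rewrite [X in _ = _ + X]big_nat_cond [X in _ = _ + X]big1 ?addr0 // => m.
by rewrite andbT => /andP[ltnm _]; rewrite /G fps_pow_lt ?scaler0.
Qed.

Definition degenerate_exp (R : numFieldType) (lam : R) : fps R :=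
  fun n => gen_falling lam 1 n / n`!%:R.

(* x(e_lam(t) - 1) in R[x][[t]], with x the polynomial variable 'X. *)
Definition bell_exponent (R : numFieldType) (lam : R) : fps {poly R} :=
  fps_scale 'X
    (fps_sub (fun n => (degenerate_exp lam n)%:P) (fps_one {poly R})).

Lemma bell_exponent0 (R : numFieldType) (lam : R) : bell_exponent lam 0%N = 0.
Proof.
rewrite /bell_exponent /fps_scale /fps_sub /degenerate_exp /gen_falling.
by rewrite big_ord0 divr1 subrr mulr0.
Qed.

Definition degenerate_bell (R : numFieldType) (lam : R) (n : nat) : {poly R} :=
  n`!%:R *: fps_exp (bell_exponent lam) n.

(* Main.v *)
Require Import Defs.
From mathcomp Require Import all_boot all_order all_algebra.
From mathcomp Require Import reals.
From mathcomp Require Import ring.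
Import Order.TTheory GRing.Theory Num.Theory.
Local Open Scope ring_scope.

(** The series [F = e^(x(e_lam(t) - 1))] satisfies [F' = x e_lam'(t) F], and the
    coefficient of [t^j/j!] in [e_lam'] is [(1)_(j+1,lam)]; hence
    [phi_(n+1) = x \sum_k 'C(n, k) phi_k (1)_(n+1-k,lam)].
    Expanding [(1)_(n+1-k,lam) = (1)_(n-k,lam) (1 - (n-k) lam)] and using
    [(n-k) 'C(n, k) = n 'C(n-1, k)] gives the identity. *)

(* Truncating to polynomials over [A] gives access to the ring structure and the
   derivation of [{poly A}]. *)
Lemma fps_pow_truncE {A : nzRingType} (f : fps A) (N m n : nat) :
  (n < N)%N -> fps_pow f m n = ((\poly_(i < N) f i) ^+ m)`_n.
Proof.
elim: m n => [|m IHm] n ltnN; first by rewrite expr0 coef1.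
rewrite exprS coefM /fps_pow iterS /fps_mul; apply: eq_bigr => i _.
rewrite coef_poly (leq_ltn_trans (leq_ord i) ltnN); congr (_ * _).
by apply: IHm; apply: leq_ltn_trans ltnN; apply: leq_subr.
Qed.

(** Coefficient of [t^n] in [(e^f)' = e^f f']: differentiating [f^(m+1)/(m+1)!] gives
    [f^m f'/m!]. *)
Lemma fps_exp_deriv {F : numFieldType} {A : comAlgType F} (f : fps A) (n : nat) :
  f 0%N = 0 ->
  fps_exp f n.+1 *+ n.+1
  = \sum_(i < n.+1) fps_exp f i * (f (n - i).+1 *+ (n - i).+1).
Proof.
(* Coefficient [n] of a derivative reads coefficient [n.+1], hence the cutoff [n.+2]. *)
move=> f0; pose p := \poly_(i < n.+2) f i.
transitivity (\sum_(m < n.+1) (m`!%:R : F)^-1 *: (p ^+ m * p^`())`_n).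
  rewrite /fps_exp big_ord_recl [fps_pow f ord0 _](_ : _ = 0) // scaler0 add0r.
  rewrite -sumrMnl.
  apply: eq_bigr => m _; rewrite lift0.
  rewrite (fps_pow_truncE _ n.+2) // scalerMnr -coef_deriv.
  rewrite deriv_exp /= coefMn -scaler_nat scalerA factS natrM invfM.
  by rewrite mulrAC mulVf ?mul1r ?pnatr_eq0 // mulrC.
under eq_bigr => m _ do rewrite coefM scaler_sumr.
rewrite exchange_big; apply: eq_bigr => i _ /=.
(* Raising the bound on [m] from [i] to [n] adds only zero terms and makes the range independent of
   [i]. *)
rewrite (fps_expE f0 (ltn_ord i)) mulr_suml; apply: eq_bigr => m _.
rewrite coef_deriv coef_poly !ltnS leq_subr scalerAl.
by rewrite (fps_pow_truncE _ n.+2) // ltnW // ltnS.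
Qed.

Lemma gen_fallingS (R : comNzRingType) (lam x : R) (n : nat) :
  gen_falling lam x n.+1 = gen_falling lam x n * (x - n%:R * lam).
Proof. by rewrite /gen_falling big_ord_recr. Qed.

(** This is the coefficient of [t^n] in [x e_lam'(t)]; the subtracted [1] only affects degree 0. *)
Lemma bell_exponentS (R : numFieldType) (lam : R) (n : nat) :
  bell_exponent lam n.+1 *+ n.+1 = 'X * (gen_falling lam 1 n.+1 / n`!%:R)%:P.
Proof.
rewrite /bell_exponent /fps_scale /fps_sub /fps_one /= subr0 -mulrnAr.
rewrite -polyCMn; congr ('X * _%:P).
rewrite /degenerate_exp factS natrM invfM mulrA -[LHS]mulr_natr mulrAC.
by rewrite divfK ?pnatr_eq0.
Qed.

Lemma degenerate_bellS (R : numFieldType) (lam : R) (n : nat) :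
  degenerate_bell lam n.+1
  = 'X * \sum_(k < n.+1) ('C(n, k)%:R * gen_falling lam 1 (n - k).+1)
                           *: degenerate_bell lam k.
Proof.
rewrite /degenerate_bell factS mulnC natrM -scalerA [n.+1%:R *: _]scaler_nat.
rewrite fps_exp_deriv ?bell_exponent0 // scaler_sumr mulr_sumr.
apply: eq_bigr => k _; rewrite bell_exponentS.
have le_kn : (k <= n)%N by rewrite -ltnS.
(* Normalizing by factorials turns the Cauchy product into a binomial convolution. *)
have coefE : 'C(n, k)%:R * gen_falling lam 1 (n - k).+1 * k`!%:R
           = n`!%:R * (gen_falling lam 1 (n - k).+1 / (n - k)`!%:R).
  rewrite -(bin_fact le_kn) !natrM.
  by field; rewrite pnatr_eq0 -lt0n fact_gt0.
rewrite [in RHS]scalerA coefE.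
by rewrite -!mul_polyC polyCM; ring.
Qed.

Theorem theorem1 (R : realType) (lam : R) (n : nat) (x : R) (hx : x != 0) :
  \sum_(0 <= k < n.+1)
      'C(n, k)%:R * (degenerate_bell lam k).[x] * gen_falling lam 1 (n - k)
  = x^-1 * (degenerate_bell lam n.+1).[x]
    + n%:R * lam *
      \sum_(0 <= k < n)
        'C(n.-1, k)%:R * (degenerate_bell lam k).[x] * gen_falling lam 1 (n - k).
Proof.
rewrite degenerate_bellS hornerM hornerX mulKf // horner_sum big_mkord.
(* The factor [n - k] vanishes at [k = n], so this sum extends to the range of the others and the
   identity can be checked term by term. *)
have -> : n%:R * lam * \sum_(0 <= k < n)
      'C(n.-1, k)%:R * (degenerate_bell lam k).[x] * gen_falling lam 1 (n - k)
    = \sum_(k < n.+1) (n - k)%:R * lam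
      * ('C(n, k)%:R * (degenerate_bell lam k).[x] * gen_falling lam 1 (n - k)).
  rewrite big_ord_recr /= subnn !mul0r addr0 big_mkord mulr_sumr.
  apply: eq_bigr => k _; have := congr1 (fun m => m%:R : R) (mul_bin_down n k).
  rewrite /= !natrM => binE; rewrite mulrAC !mulrA [n%:R * _]binE.
  by ring.
rewrite -big_split; apply: eq_bigr => k _ /=.
by rewrite [X in _ = X + _]hornerZ gen_fallingS; ring.
Qed.
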